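(* Let $\alpha>1$, $\beta>0$, $A_\circ>0$, $A_\circ'>0$, $\triangle>0$, $R_{\mathrm{y}}\ge\triangle$, $\lambda_{\mathrm{y}}>0$, $p_{\mathrm{I}}\in[0,1]$. Let $\mathbf{x}_{\mathrm{rx}}=x_{\mathrm{rx}}\mathbf{e}_{\mathrm{x}}$ with $x_{\mathrm{rx}}\in\mathbb{R}$, and let $\mathbf{x}_{\mathrm{tx}}=x_{\mathrm{tx}}\mathbf{e}_{\mathrm{x}}+y_{\mathrm{tx}}\mathbf{e}_{\mathrm{y}}$ with $x_{\mathrm{tx}},y_{\mathrm{tx}}\in\mathbb{R}$, $x_{\mathrm{tx}}y_{\mathrm{tx}}=0$ and $\mathbf{x}_{\mathrm{tx}}\neq\mathbf{x}_{\mathrm{rx}}$. With the urban path loss $\ell_{\mathrm{pl}}=\ell_{\mathrm{pl}}^{\mathrm{u}}$ (defined in the context), put $$\zeta_{\mathrm{u}}=\Bigl(A_\circ\beta/\ell_{\mathrm{pl}}^{\mathrm{u}}(\mathbf{x}_{\mathrm{tx}},\mathbf{x}_{\mathrm{rx}})\Bigr)^{1/\alpha},\qquad \kappa=(A_\circ/A_\circ')^{1/\alpha}\|\mathbf{x}_{\mathrm{rx}}\|.$$ Then the quantity $\mathcal{P}_\circ(\Phi_{\mathrm{y}})$ (defined in the context) satisfies $$\mathcal{P}_\circ(\Phi_{\mathrm{y}})=\exp\bigl(-p_{\mathrm{I}}\lambda_{\mathrm{y}}\zeta_{\mathrm{u}}\,\mathcal{Y}(R_{\mathrm{y}})\bigr),$$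 where $$\mathcal{Y}(R_{\mathrm{y}})=2\biggl(g_\circ\Bigl(\alpha,\tfrac{R_{\mathrm{y}}+\|\mathbf{x}_{\mathrm{rx}}\|}{\zeta_{\mathrm{u}}}\Bigr)\mathbf{1}_{\|\mathbf{x}_{\mathrm{rx}}\|\le\triangle}+\biggl[g_\circ\Bigl(\alpha,\tfrac{\triangle+\|\mathbf{x}_{\mathrm{rx}}\|}{\zeta_{\mathrm{u}}}\Bigr)+\frac1\kappa\Bigl(g_\circ\bigl(\alpha,\tfrac{\kappa R_{\mathrm{y}}}{\zeta_{\mathrm{u}}}\bigr)-g_\circ\bigl(\alpha,\tfrac{\kappa\triangle}{\zeta_{\mathrm{u}}}\bigr)\Bigr)\biggr]\mathbf{1}_{\|\mathbf{x}_{\mathrm{rx}}\|>\triangle}-g_\circ\Bigl(\alpha,\tfrac{\|\mathbf{x}_{\mathrm{rx}}\|}{\zeta_{\mathrm{u}}}\Bigr)\biggr).$$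
   Context: Notation: $\mathbf{e}_{\mathrm{x}}=[1\ 0]^{\mathrm T}$, $\mathbf{e}_{\mathrm{y}}=[0\ 1]^{\mathrm T}$; $\|\cdot\|$ is the Euclidean norm on $\mathbb{R}^2$; $\mathbf{1}_{\mathsf Q}=1$ if statement $\mathsf Q$ is true and $0$ otherwise (a term multiplied by a vanishing indicator is read as $0$). Urban path loss ($\triangle$ is the break-point distance): for a receiver $\mathbf{x}_{\mathrm{rx}}$ on the horizontal road and a point $\mathbf{x}\ne\mathbf{x}_{\mathrm{rx}}$ on one of the two roads (coordinate axes), (i) if $\mathbf{x}=y\mathbf{e}_{\mathrm{y}}$ is on the vertical road and $\min(|y|,\|\mathbf{x}_{\mathrm{rx}}\|)>\triangle$, then $\ell_{\mathrm{pl}}^{\mathrm{u}}(\mathbf{x},\mathbf{x}_{\mathrm{rx}})=A_\circ'(\|\mathbf{x}\|\cdot\|\mathbf{x}_{\mathrm{rx}}\|)^{-\alpha}$; (ii) if $\mathbf{x}=y\mathbf{e}_{\mathrm{y}}$ is on the vertical road and $\min(|y|,\|\mathbf{x}_{\mathrm{rx}}\|)\le\triangle$, then $\ell_{\mathrm{pl}}^{\mathrm{u}}(\mathbf{x},\mathbf{x}_{\mathrm{rx}})=A_\circ(\|\mathbf{x}\|+\|\mathbf{x}_{\mathrm{rx}}\|)^{-\alpha}$; (iii) if $\mathbf{x}=x\mathbf{e}_{\mathrm{x}}$ is on the horizontal road, then $\ell_{\mathrm{pl}}^{\mathrm{u}}(\mathbf{x},\mathbf{x}_{\mathrm{rx}})=A_\circ\|\mathbf{x}_{\mathrm{rx}}-\mathbf{x}\|^{-\alpha}$.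 (At $\mathbf{x}=\mathbf{0}$, cases (ii) and (iii) agree.) Interferers: $\Phi_{\mathrm{y}}$ is the set of random points $y\mathbf{e}_{\mathrm{y}}$ on the vertical road, where the coordinates $y$ form a homogeneous Poisson point process of intensity $p_{\mathrm{I}}\lambda_{\mathrm{y}}$ on $\mathcal{B}_{\mathrm{y}}=\{y\in\mathbb{R}: |y|\le R_{\mathrm{y}}\}$. To each point $\mathbf{x}\in\Phi_{\mathrm{y}}$ is attached a fading variable $\ell_{\mathrm{f}}(\mathbf{x})$; these are i.i.d. exponential of mean $1$ and independent of $\Phi_{\mathrm{y}}$. The normalized aggregate interference is $I(\Phi_{\mathrm{y}})=\sum_{\mathbf{x}\in\Phi_{\mathrm{y}}}\ell_{\mathrm{f}}(\mathbf{x})\,\ell_{\mathrm{pl}}(\mathbf{x},\mathbf{x}_{\mathrm{rx}})$. Definition: $\mathcal{P}_\circ(\Phi_{\mathrm{y}})=\mathbb{E}\{\exp(-\beta' I(\Phi_{\mathrm{y}}))\}$, where $\beta'=\beta/\ell_{\mathrm{pl}}(\mathbf{x}_{\mathrm{tx}},\mathbf{x}_{\mathrm{rx}})$. The function $g_\circ$: for $\alpha>0$ and $\vartheta\ge 0$, $g_\circ(\alpha,\vartheta)=\int_0^{\vartheta}\frac{\mathrm{d}u}{1+u^{\alpha}}=\vartheta\,{}_2F_1\bigl(1,\tfrac1\alpha;1+\tfrac1\alpha;-\vartheta^{\alpha}\bigr)$, with ${}_2F_1$ the Gauss hypergeometric function. *)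

(* Defs.v *)
From HB Require Import structures.
From mathcomp Require Import all_boot all_order all_algebra.
From mathcomp Require Import finmap.
From mathcomp Require Import all_classical all_reals all_analysis.

Set Implicit Arguments.
Unset Strict Implicit.
Unset Printing Implicit Defensive.

Import Order.TTheory GRing.Theory Num.Theory.
Import numFieldNormedType.Exports.

Local Open Scope classical_set_scope.
Local Open Scope ring_scope.

Section Plane.
Context {R : realType}.
Implicit Types x x_rx : 'cV[R]_2.

Definition e_x : 'cV[R]_2 := delta_mx 0 0.
Definition e_y : 'cV[R]_2 := delta_mx 1 0.

(* The library norm on matrices is the sup norm, hence this definition. *)
Definition enorm x : R := Num.sqrt (\sum_i x i 0 ^+ 2).

(* Meant for [x_rx] on the horizontal axis and [x != x_rx] on one of the axes;
   every other value is junk.  The point [x = 0] falls under the vertical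
   road, where its value is [A * enorm x_rx `^ (- alpha)], the same as for the
   horizontal road. *)
Definition lpl_u (alpha A A' tri : R) x x_rx : R :=
  if x 0 0 == 0 then
    if tri < Num.min `|x 1 0| (enorm x_rx)
    then A' * (enorm x * enorm x_rx) `^ (- alpha)
    else A * (enorm x + enorm x_rx) `^ (- alpha)
  else A * enorm (x_rx - x) `^ (- alpha).

Definition g_circ (alpha theta : R) : R :=
  \int[lebesgue_measure]_(u in `[0, theta]) (1 + u `^ alpha)^-1.

Definition zeta_u (alpha beta A A' tri : R) (x_tx x_rx : 'cV[R]_2) : R :=
  (A * beta / lpl_u alpha A A' tri x_tx x_rx) `^ alpha^-1.

Definition kappa (alpha A A' : R) (x_rx : 'cV[R]_2) : R :=
  (A / A') `^ alpha^-1 * enorm x_rx.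

(* [r], [z], [k] stand for [enorm x_rx], [zeta_u] and [kappa].  If [k = 0]
   then [k^-1 = 0], but in that case [r = 0] and the second indicator
   vanishes. *)
Definition calY (alpha tri r z k Ry : R) : R :=
  2 * (g_circ alpha ((Ry + r) / z) * (r <= tri)%R%:R
       + (g_circ alpha ((tri + r) / z)
          + k^-1 * (g_circ alpha (k * Ry / z) - g_circ alpha (k * tri / z)))
         * (tri < r)%R%:R
       - g_circ alpha (r / z)).

End Plane.

Section Independence.
Context {d : measure_display} {T : measurableType d} {R : realType}.
Variable P : probability T R.

Definition sigma_of d' (T' : measurableType d') (X : T -> T') : set (set T) :=
  preimage_set_system setT X measurable.

Definition mutually_independent (I : choiceType) (G : I -> set (set T)) : Prop :=
  forall (J : {fset I}) (E : I -> set T),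
    (forall i, i \in J -> G i (E i)) ->
    P (\bigcap_(i in [set` J]) E i) = (\prod_(i <- J) P (E i))%E.

Definition independent2 (G H : set (set T)) : Prop :=
  forall E F, G E -> H F -> P (E `&` F) = (P E * P F)%E.

End Independence.

Section PointProcess.
Context {d : measure_display} {T : measurableType d} {R : realType}.
Variable P : probability T R.
Implicit Types (Psi : T -> set R) (lf : T -> R -> R) (A B : set R).

Definition npoints Psi A (w : T) : nat := #|` fset_set (Psi w `&` A)|.

(* Homogeneous Poisson point process of intensity [lam] on a set [B] of finite
   Lebesgue measure, as a random finite subset of [B].  The second argument of
   [poisson_prob] is a dummy on which it does not depend; [poisson_prob 0 0] is
   the Dirac mass at [0]. *)
Definition homogeneous_ppp (lam : R) B Psi : Prop :=
  [/\ (forall w, Psi w `<=` B /\ finite_set (Psi w)),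
      (forall A, measurable A -> A `<=` B ->
         measurable_fun setT (npoints Psi A)),
      (forall A, measurable A -> A `<=` B -> forall K : set nat,
         P (npoints Psi A @^-1` K) =
         poisson_prob (lam * fine (lebesgue_measure A)) 0 K) &
      (forall A_ : nat -> set R,
         (forall i, measurable (A_ i) /\ A_ i `<=` B) -> trivIset setT A_ ->
         mutually_independent P (fun i => sigma_of (npoints Psi (A_ i))))].

(* Independent marking: there is a measurable enumeration without repetition
   [Y 0, ..., Y (N - 1)] of the points such that the mark of [Y n] is [F n],
   where the [F n] are i.i.d. exponential of mean 1 and the sequence [F] is
   independent of the enumeration [(N, Y)].  The values [Y n] for [n >= N] are
   padding. *)
Definition iid_exp1_marks Psi lf : Prop :=
  exists (N : {RV P >-> nat}) (Y F : nat -> {RV P >-> R}),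
    [/\ (forall w, Psi w = [set Y n w | n in [set n | (n < N w)%N]]),
        (forall w m n, (m < N w)%N -> (n < N w)%N -> Y m w = Y n w -> m = n),
        (forall w n, (n < N w)%N -> lf w (Y n w) = F n w),
        (forall n K, measurable K ->
           distribution P (F n) K = exponential_prob 1 K)
          /\ mutually_independent P (fun n => sigma_of (F n)) &
        independent2 P
          <<s \bigcup_n sigma_of (F n) >>
          <<s sigma_of N `|` \bigcup_n sigma_of (Y n) >>].

Definition vertical_points Psi (w : T) : set 'cV[R]_2 :=
  [set y *: e_y | y in Psi w].

Definition interference (Phi : T -> set 'cV[R]_2) (lf : T -> 'cV[R]_2 -> R)
    (lpl : 'cV[R]_2 -> 'cV[R]_2 -> R) (x_rx : 'cV[R]_2) (w : T) : R :=
  \sum_(x \in Phi w) lf w x * lpl x x_rx.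

Definition P_circ (beta : R) (lpl : 'cV[R]_2 -> 'cV[R]_2 -> R)
    (x_tx x_rx : 'cV[R]_2) (Phi : T -> set 'cV[R]_2)
    (lf : T -> 'cV[R]_2 -> R) : \bar R :=
  'E_P[fun w => expR (- (beta / lpl x_tx x_rx)
                        * interference Phi lf lpl x_rx w)].

End PointProcess.

(* Main.v *)
Require Import Defs.
From HB Require Import structures.
From mathcomp Require Import all_boot all_order all_algebra.
From mathcomp Require Import finmap.
From mathcomp Require Import all_classical all_reals all_analysis.
From mathcomp Require Import measurable_realfun ring lra.

Import Order.TTheory GRing.Theory Num.Theory.
Import numFieldNormedType.Exports.

Local Open Scope classical_set_scope.
Local Open Scope ring_scope.

(** A random variable with the right integrals against indicators has the right
    integrals against all nonnegative functions; applied one factor at a time,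
    this turns independence of events into factorization of expectations.
    Suppose first that the attenuation [s y] takes finitely many values.
    Splitting along the values of [s (Y i)], which are independent of the
    marks, replaces each factor [exp (- F i * s (Y i))] by its mean
    [1 / (1 + s (Y i))].  The resulting product over the points depends only on
    the numbers of points in the level sets of [s], which are independent
    Poisson variables, so its expectation is
    [exp (- lam * \int_B (1 - 1 / (1 + s)))].  Dominated convergence extends
    this to every measurable [s >= 0].  For the urban path loss, the integrand
    is [1 / (1 + u ^ alpha)] after an affine substitution on each of the pieces
    [0 < |y| <= tri] and [tri < |y| <= Ry]. *)

(** * Integrals determined by integrals against indicators *)

Section Transfer.
Context {d : measure_display} {T : measurableType d} {R : realType}.
Import HBNNSimple.

(* The factor [c] and the two base measures cover both a density on the
   codomain ([X := id], [c := 1]) and an independent factor ([mu := nu],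
   [X := Z], [c] the mean of [g]). *)
Lemma integral_density_comp {d0} {S : measurableType d0}
    {d'} {T' : measurableType d'}
    (mu : {measure set T -> \bar R}) (nu : {measure set S -> \bar R})
    (X : T -> T') (Z : S -> T') (g : T -> R) (c : R) (f : T' -> R) :
  measurable_fun setT X -> measurable_fun setT Z -> measurable_fun setT g -> (forall w, 0 <= g w) ->
  0 <= c ->
  (forall K, measurable K ->
    \int[mu]_w (g w * \1_K (X w))%:E = c%:E * nu (Z @^-1` K))%E ->
  measurable_fun setT f -> (forall x, 0 <= f x) ->
  (\int[mu]_w (g w * f (X w))%:E = c%:E * \int[nu]_w (f (Z w))%:E)%E.
Proof.
move=> mX mZ mg g0 c0 gK mf f0.
have mEf : measurable_fun [set: T'] (fun x => (f x)%:E) by exact/measurable_EFinP.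
pose h := nnsfun_approx measurableT mEf.
have hf x : (h n x)%:E @[n --> \oo] --> (f x)%:E.
  by apply: (cvg_nnsfun_approx measurableT mEf) => //= y _; rewrite lee_fin.
have hnd x : {homo (fun n => h n x) : m n / (m <= n)%N >-> m <= n}.
  by move=> m n mn; exact/lefP/nd_nnsfun_approx.
have mh n : measurable_fun setT (fun w => h n (X w)) by exact: measurableT_comp.
have mhZ n : measurable_fun setT (fun w => h n (Z w)) by exact: measurableT_comp.
have mind y n : measurable_fun setT (fun w => \1_(h n @^-1` [set y]) (X w) : R).
  by apply: measurableT_comp.
have mindZ y n : measurable_fun setT (fun w => \1_(h n @^-1` [set y]) (Z w) : R).
  by apply: measurableT_comp.
(* A simple function is a finite combination of indicators of its level sets, and [gK] applies to
   each of them. Monotone convergence along [h] then reaches [f] on both sides. *)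
have step n : (\int[mu]_w (g w * h n (X w))%:E
               = c%:E * \int[nu]_w (h n (Z w))%:E)%E.
  transitivity (\sum_(y \in range (h n))
      \int[mu]_w (y%:E * (g w * \1_(h n @^-1` [set y]) (X w))%:E))%E.
    rewrite -ge0_integral_fsum//=.
    - apply: eq_integral => w _; rewrite {1}fimfunE mulr_fsumr -fsumEFin//.
      by apply: eq_fsbigr => y _; rewrite mulrCA.
    - move=> y; apply/measurable_EFinP; apply: measurable_funM => //.
      exact: measurable_funM.
    (* The coefficient [y] is arbitrary here and may be negative, but then [h n] never takes the
       value [y] and the indicator vanishes. *)
    - move=> y w _; rewrite -EFinM lee_fin.
      rewrite mulrCA mulr_ge0//.
      rewrite indicE; case: (boolP (_ \in _)); last by rewrite mulr0.
      by rewrite inE /= => <-; rewrite mulr1.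
  transitivity (\sum_(y \in range (h n))
      c%:E * \int[nu]_w (y%:E * (\1_(h n @^-1` [set y]) (Z w))%:E))%E.
    apply: eq_fsbigr => y /set_mem [x _ <-].
    rewrite ge0_integralZl_EFin//; last 2 first.
    - by move=> w _; rewrite lee_fin mulr_ge0.
    - by apply/measurable_EFinP; exact: measurable_funM.
    rewrite gK// ge0_integralZl_EFin//; last exact/measurable_EFinP.
    rewrite muleCA; congr (_ * (_ * _))%E.
    rewrite -[RHS]/(\int[nu]_w (\1_(Z @^-1` (h n @^-1` [set h n x])) w)%:E)%E.
    rewrite integral_indic// ?setIT//.
    by rewrite -[X in measurable X]setTI; apply: mZ.
  rewrite -ge0_mule_fsumr; last first.
    move=> y; apply: integral_ge0 => w _; rewrite -EFinM lee_fin.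
    rewrite indicE; case: (boolP (_ \in _)); last by rewrite mulr0.
    by rewrite inE /= => <-; rewrite mulr1.
  congr (_ * _)%E; rewrite -ge0_integral_fsum//=.
  - apply: eq_integral => w _; rewrite [in RHS](fimfunE (h n)) -fsumEFin//.
  - by move=> y; apply/measurable_EFinP; exact: measurable_funM.
  - move=> y w _; rewrite -EFinM lee_fin.
    rewrite indicE; case: (boolP (_ \in _)); last by rewrite mulr0.
    by rewrite inE /= => <-; rewrite mulr1.
have L : (\int[mu]_w (g w * h n (X w))%:E @[n --> \oo]
    --> \int[mu]_w (g w * f (X w))%:E)%E.
  have -> : (\int[mu]_w (g w * f (X w))%:E
             = \int[mu]_w limn (fun n => (g w * h n (X w))%:E))%E.
    apply: eq_integral => w _; apply/esym/cvg_lim => //.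
    under eq_fun do rewrite EFinM.
    by rewrite EFinM; apply: cvgeZl => //; exact: hf.
  apply: cvg_monotone_convergence => //.
  - by move=> n; apply/measurable_EFinP; exact: measurable_funM.
  - by move=> n w _; rewrite lee_fin mulr_ge0.
  - by move=> w _ m n mn; rewrite lee_fin ler_wpM2l// hnd.
have Rt : (\int[nu]_w (h n (Z w))%:E @[n --> \oo]
    --> \int[nu]_w (f (Z w))%:E)%E.
  have -> : (\int[nu]_w (f (Z w))%:E
             = \int[nu]_w limn (fun n => (h n (Z w))%:E))%E.
    by apply: eq_integral => w _; apply/esym/cvg_lim => //; exact: hf.
  apply: cvg_monotone_convergence => //.
  - by move=> n; apply/measurable_EFinP.
  - by move=> n w _; rewrite lee_fin.
  - by move=> w _ m n mn; rewrite lee_fin hnd.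
have Rt' := cvgeZl (erefl : c%:E \is a fin_num) Rt.
have -> := esym (cvg_lim (@ereal_hausdorff R) L).
rewrite (eq_fun step).
exact: (cvg_lim (@ereal_hausdorff R) Rt').
Qed.

(** On the event [V = y] the parameter of [G] is the constant [y]. This is how a random parameter
    with finitely many values is frozen before independence is used. *)
Lemma integral_split_range (mu : {measure set T -> \bar R}) (V : T -> R) (E : set T) (G : R -> T -> R) :
  measurable_fun setT V -> finite_set (range V) -> measurable E ->
  (forall y, measurable_fun setT (G y)) -> (forall y w, 0 <= G y w) ->
  (\int[mu]_w (\1_E w * G (V w) w)%:E = \sum_(y \in range V)
     \int[mu]_w (\1_(E `&` V @^-1` [set y]) w * G y w)%:E)%E.
Proof.
move=> mV finV mE mG G0.
have mEV y : measurable (E `&` V @^-1` [set y]).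
  by apply: measurableI => //; rewrite -[X in measurable X]setTI; apply: mV.
rewrite -ge0_integral_fsum//=.
- apply: eq_integral => w _; rewrite fsumEFin//; congr EFin.
  have Vw : range V (V w) by exists w.
  rewrite (fsbigD1 (V w))// fsbig1 /=.
  + by rewrite addr0 indicI /= [X in _ * X * _]indicE mem_set// mulr1.
  + by move=> y [_ /= /nesym yV]; rewrite indicI/= [X in _ * X * _]indicE memNset// mulr0 mul0r.
- move=> y; apply/measurable_EFinP; apply: measurable_funM => //.
- by move=> y w _; rewrite lee_fin mulr_ge0.
Qed.

End Transfer.

(** * From product formulas for events to product formulas for expectations *)

Section Independence.
Context {d : measure_display} {T : measurableType d} {R : realType}.
Variable mu : probability T R.

(** Induction on [m]: the last factor is moved into the weight [g], and its mean into [c]. The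
    indicator hypothesis for the new weight follows from [integral_density_comp], with the old
    weight times the other indicators as density. The weight also allows a restriction to an event,
    by taking [g] to be its indicator. *)
Lemma integral_prod_comp {d'} {T' : measurableType d'} (m : nat)
    (X : nat -> T -> T') (f : nat -> T' -> R) (e : nat -> R)
    (g : T -> R) (c : R) :
  (forall i, measurable_fun setT (X i)) ->
  measurable_fun setT g -> (forall w, 0 <= g w) -> 0 <= c ->
  (forall i, measurable_fun setT (f i)) -> (forall i x, 0 <= f i x) ->
  (forall i, (i < m)%N -> \int[mu]_w (f i (X i w))%:E = (e i)%:E)%E ->
  (forall K : nat -> set T', (forall i, measurable (K i)) ->
    \int[mu]_w (g w * \prod_(i < m) \1_(K i) (X i w))%:E
    = c%:E * \prod_(i < m) mu (X i @^-1` K i))%E ->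
  (\int[mu]_w (g w * \prod_(i < m) f i (X i w))%:E
   = (c * \prod_(i < m) e i)%:E)%E.
Proof.
move=> mX + + + mf f0; elim: m g c => [|m IH] g c mg g0 c0 fe gK.
  have := gK (fun=> setT) (fun=> measurableT).
  rewrite !big_ord0 mule1 mulr1 => <-.
  by apply: eq_integral => w _; rewrite !big_ord0.
have e0 i : (i < m.+1)%N -> 0 <= e i.
  by move=> /fe fi; rewrite -lee_fin -fi; apply: integral_ge0 => w _; rewrite lee_fin.
have mfX i : measurable_fun setT (fun w => f i (X i w)) by exact: measurableT_comp.
transitivity (\int[mu]_w (g w * f m (X m w) * \prod_(i < m) f i (X i w))%:E)%E.
  apply: eq_integral => w _; rewrite big_ord_recr/=; congr EFin; ring.
rewrite (IH (fun w => g w * f m (X m w)) (c * e m)).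
- by rewrite big_ord_recr/=; congr EFin; ring.
- exact: measurable_funM.
- by move=> w; rewrite mulr_ge0.
- by rewrite mulr_ge0// e0.
- by move=> i im; rewrite fe// ltnS ltnW.
move=> K mK.
have mKX i : measurable_fun setT (fun w => \1_(K i) (X i w) : R).
  by apply: measurableT_comp.
have mXK i A : measurable A -> measurable (X i @^-1` A).
  by move=> mA; rewrite -[X in measurable X]setTI; apply: mX.
have K0 w : 0 <= \prod_(i < m) (\1_(K i) (X i w) : R).
  by apply: prodr_ge0.
under eq_integral do rewrite mulrAC.
have cK : (c%:E * \prod_(i < m) mu (X i @^-1` K i))%E \is a fin_num.
  rewrite fin_numM// prode_fin_num// => i _.
  by rewrite fin_num_measure//; exact: mXK.
rewrite (@integral_density_comp _ _ _ _ _ _ _ mu mu (X m) (X m)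
  (fun w => g w * \prod_(i < m) \1_(K i) (X i w))
  (fine (c%:E * \prod_(i < m) mu (X i @^-1` K i)))%E (f m))//.
- rewrite fineK// fe// EFinM; rewrite -!muleA; congr (_ * _)%E.
  by rewrite muleC.
- by apply: measurable_funM => //; apply: measurable_prod.
- by move=> w; rewrite mulr_ge0.
- by apply: fine_ge0; apply: mule_ge0 => //; apply: prode_ge0 => //.
- move=> A mA; rewrite fineK//.
  (* The hypothesis [gK] is applied to the [m.+1] sets [K 0, ..., K (m - 1), A]. *)
  pose K' i := if i == m then A else K i.
  have mK' i : measurable (K' i) by rewrite /K'; case: ifP.
  have := gK K' mK'; rewrite !big_ord_recr/=.
  rewrite (eq_bigr (fun i : 'I_m => mu (X i @^-1` K i))); last first.
    by move=> i _; rewrite /K' ltn_eqF.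
  rewrite {2}/K' eqxx muleA => <-.
  apply: eq_integral => w _; rewrite big_ord_recr/= mulrA {2}/K' eqxx.
  congr (_ * _ * _)%:E; apply: eq_bigr => i _; by rewrite /K' ltn_eqF.
Qed.
End Independence.

(** * Functions with a random integer index *)

Section CountableIndex.
Context {d : measure_display} {T : measurableType d} {R : realType}.
Variables (P : probability T R) (N : T -> nat).
Hypothesis mN : measurable_fun setT N.

Let mNn n : measurable (N @^-1` [set n]).
Proof. by rewrite -[X in measurable X]setTI; apply: mN. Qed.

Lemma measurable_fun_index (u : nat -> T -> R) :
  (forall n, measurable_fun setT (u n)) ->
  measurable_fun setT (fun w => u (N w) w).
Proof.
move=> mu _ A mA; rewrite setTI.
have -> : (fun w => u (N w) w) @^-1` A
    = \bigcup_n (N @^-1` [set n] `&` u n @^-1` A).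
  apply/seteqP; split=> [w /= Aw|w [n _ /= [<- //]]]; first by exists (N w).
apply: bigcupT_measurable => n; apply: measurableI => //.
by rewrite -[X in measurable X]setTI; apply: mu.
Qed.

(** The sets [N = n] partition the space. This reduces products with a random number of factors to
    products of fixed length, and expectations of functions of a Poisson variable to series. *)
Lemma integral_index (u : nat -> T -> R) :
  (forall n, measurable_fun setT (u n)) -> (forall n w, 0 <= u n w) ->
  (\int[P]_w (u (N w) w)%:E
   = \sum_(n <oo) \int[P]_w (\1_(N @^-1` [set n]) w * u n w)%:E)%E.
Proof.
move=> mu u0.
have cover : \bigcup_n (N @^-1` [set n]) = setT.
  by apply/seteqP; split=> // w _; exists (N w).
rewrite -{1}cover ge0_integral_bigcup//=.
- apply: eq_eseriesr => n _.
  rewrite [LHS]integral_mkcond; apply: eq_integral => w _.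
  rewrite patchE indicE; case: (boolP (w \in _)); last by rewrite mul0r.
  by rewrite inE /= => ->; rewrite mul1r.
- by rewrite cover; apply/measurable_EFinP; exact: measurable_fun_index.
- by move=> w _; rewrite lee_fin.
- by move=> i j _ _ [w /= [<-]].
Qed.

End CountableIndex.

(** * Integrating out the exponential marks *)

Section Marks.
Context {d : measure_display} {T : measurableType d} {R : realType}.
Variable P : probability T R.

(** Multiplying the density of rate [1] by [exp (- b x)] gives [1 / (1 + b)] times the density of
    rate [1 + b], whose total mass is [1]. *)
Lemma integral_expR_exponential (F : {RV P >-> R}) (b : R) :
  (forall K, measurable K -> distribution P F K = exponential_prob 1 K) ->
  0 <= b -> (\int[P]_w (expR (- (b * F w)))%:E = ((1 + b)^-1)%:E)%E.
Proof.
move=> FE b0.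
have b1 : 0 < 1 + b by rewrite ltr_wpDr.
have pdf0 r (x : R) : 0 <= r -> 0 <= exponential_pdf r x.
  by move=> r0; exact: exponential_pdf_ge0.
rewrite -[LHS]mul1e.
rewrite -(@integral_density_comp _ _ R _ _ _ _ lebesgue_measure P id F
  (exponential_pdf 1) 1 (fun x => expR (- (b * x))))//=; last 5 first.
- exact: (measurable_funPT F).
- exact: measurable_exponential_pdf.
- by move=> x; apply: pdf0.
- move=> K mK; rewrite mul1e -/(pushforward P F K) -/(distribution P F K) FE//.
  rewrite /exponential_prob [RHS]integral_mkcond; apply: eq_integral => x _.
  by rewrite patchE indicE; case: ifP => _; rewrite ?mulr1 ?mulr0.
- by do 3 apply: measurableT_comp => //=; exact: measurable_funM.
transitivity (\int[lebesgue_measure]_x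
    ((1 + b)^-1%:E * (exponential_pdf (1 + b) x)%:E))%E.
  apply: eq_integral => x _; rewrite -EFinM; congr EFin.
  have [x0|x0] := leP 0 x; last by rewrite !lt0_exponential_pdf// mul0r mulr0.
  rewrite !exponential_pdfE// mul1r -expRD mulrA mulVf ?gt_eqF// mul1r.
  by congr expR; ring.
rewrite ge0_integralZl_EFin//.
- by rewrite integral_exponential_pdf// mule1.
- by move=> x _; rewrite lee_fin pdf0// ltW.
- by apply/measurable_EFinP; exact: measurable_exponential_pdf.
- by rewrite invr_ge0 ltW.
Qed.

Lemma prod_indicE (m : nat) {T' : Type} (X : nat -> T -> T')
    (K : nat -> set T') w :
  \prod_(i < m) \1_(K i) (X i w) = \1_(\bigcap_(i in `I_m) X i @^-1` K i) w :> R.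
Proof.
elim: m => [|m IH].
  by rewrite big_ord0 indicE mem_set.
by rewrite big_ord_recr/= IH !bigcap_mkord big_ord_recr indicI.
Qed.

Lemma measurable_inv1D (f : T -> R) : measurable_fun setT f ->
  (forall w, 0 <= f w) -> measurable_fun setT (fun w => (1 + f w)^-1).
Proof.
move=> mf f0.
have -> : (fun w => (1 + f w)^-1) = (fun w => (1 + f w) `^ (-1)).
  by apply/funext => w; rewrite powR_inv1// addr_ge0.
apply: (measurableT_comp (f := fun x : R => x `^ (-1)) (measurable_powR (-1))).
exact: measurable_funD.
Qed.

Lemma mutually_independent_bigcap {d'} {T' : measurableType d'}
    (X : nat -> T -> T') (K : nat -> set T') (m : nat) :
  mutually_independent P (fun i => sigma_of (X i)) ->
  (forall i, measurable (K i)) ->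
  (P (\bigcap_(i in `I_m) X i @^-1` K i) = \prod_(i < m) P (X i @^-1` K i))%E.
Proof.
move=> indX mK.
have := indX [fset i in iota 0 m]%fset (fun i => X i @^-1` K i).
have -> : [set` [fset i in iota 0 m]%fset] = `I_m.
  by apply/seteqP; split=> i; rewrite /= !inE mem_iota.
rewrite (perm_big (index_iota 0 m)); last first.
  apply: uniq_perm; rewrite ?iota_uniq ?fset_uniq// => i.
  by rewrite !inE /index_iota subn0.
rewrite big_mkord => -> //.
by move=> i _; exists (K i) => //; rewrite setTI.
Qed.

(** In the application [H] is the sigma-algebra generated by the enumeration of the points. Only its
    stability under intersection matters here, so that conditioning events can be refined one level
    set at a time. *)
Variable H : set (set T).
Hypothesis HI : setI_closed H.
Hypothesis mH : H `<=` measurable.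

(** Conditioning without conditional expectations, by induction on the number of attenuations that
    are still random. Splitting along the values of one of them freezes it, and its level set is
    absorbed into the event, which stays in [H]. Once all are constant, the marks are independent of
    the event and each factor has mean [1 / (1 + b i)]. *)
Lemma integral_expR_marks (M : nat) (F C : nat -> T -> R) (E : set T) :
  (forall i, measurable_fun setT (F i)) ->
  (forall i (b : R), (0 <= b)%R ->
     \int[P]_w (expR (- (b * F i w)))%:E = ((1 + b)^-1)%:E)%E ->
  (forall A (K : nat -> set R), H A -> (forall i, measurable (K i)) ->
     P (A `&` \bigcap_(i in `I_M) F i @^-1` K i)
     = P A * \prod_(i < M) P (F i @^-1` K i))%E ->
  (forall i, measurable_fun setT (C i)) -> (forall i w, 0 <= C i w) ->
  (forall i, finite_set (range (C i))) ->
  (forall i y, H (C i @^-1` [set y])) -> H E ->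
  (\int[P]_w (\1_E w * \prod_(i < M) expR (- (C i w * F i w)))%:E
   = \int[P]_w (\1_E w * \prod_(i < M) (1 + C i w)^-1)%:E)%E.
Proof.
move=> mF FE FK mC C0 finC HC HE.
(* The first [m] attenuations are random, the others are frozen to [b]. *)
pose c m b i w := if (i < m)%N then C i w else b i.
have c0 m b i w : (forall i, 0 <= b i) -> 0 <= c m b i w.
  by move=> b0; rewrite /c; case: ifP.
have mc m b i : measurable_fun setT (c m b i).
  by rewrite /c; case: (i < m)%N.
pose u m b w := \prod_(i < M) expR (- (c m b i w * F i w)).
pose v m b w := \prod_(i < M) (1 + c m b i w)^-1.
have mu m b : measurable_fun setT (u m b).
  apply: measurable_prod => i _ /=; apply: measurableT_comp => //.
  by apply: measurableT_comp => //; exact: measurable_funM.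
have mv m b : (forall i, 0 <= b i) -> measurable_fun setT (v m b).
  move=> b0; apply: measurable_prod => i _.
  by apply: measurable_inv1D => // w; apply: c0.
have u0 m b w : 0 <= u m b w by apply: prodr_ge0 => i _; exact: expR_ge0.
have v0 m b w : (forall i, 0 <= b i) -> 0 <= v m b w.
  by move=> b0; apply: prodr_ge0 => i _; rewrite invr_ge0 addr_ge0// c0.
suff main m b A : (m <= M)%N -> (forall i, 0 <= b i) -> H A ->
    (\int[P]_w (\1_A w * u m b w)%:E = \int[P]_w (\1_A w * v m b w)%:E)%E.
  have := main M (fun=> 0) E (leqnn M) (fun=> lexx 0) HE.
  have cM i w : (i < M)%N -> c M (fun=> 0) i w = C i w by rewrite /c => ->.
  under eq_integral do under [u _ _ _]eq_bigr do rewrite cM//.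
  move=> ->; apply: eq_integral => w _; congr (_ * _)%:E.
  by apply: eq_bigr => i _; rewrite cM.
elim: m b A => [|m IH] b A mM b0 HA.
  have mA := mH A HA.
  (* All attenuations are constant: the indicator of [A] serves as weight, of mean [P A]. *)
  have -> : v 0 b = fun=> \prod_(i < M) (1 + b i)^-1 by [].
  rewrite (@integral_prod_comp _ _ _ P _ _ M F (fun i x => expR (- (b i * x)))
    (fun i => (1 + b i)^-1) \1_A (fine (P A)))//; first last.
  - move=> K mK; rewrite fineK ?fin_num_measure// -FK//.
    under eq_integral do rewrite prod_indicE -[_ * _]/((\1_A \* _) _) -indicI.
    rewrite integral_indic ?setIT//.
    apply: measurableI => //; apply: bigcap_measurableType => i _.
    by rewrite -[X in measurable X]setTI; apply: mF.
  - by move=> i _; apply: FE.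
  - by move=> i; do 2 apply: measurableT_comp => //; exact: measurable_funM.
  - by rewrite fine_ge0.
  under eq_integral do rewrite mulrC EFinM.
  rewrite ge0_integralZl_EFin//; first last.
  - by apply: prodr_ge0 => i _; rewrite invr_ge0 addr_ge0.
  - exact/measurable_EFinP.
  by rewrite integral_indic// setIT EFinM muleC fineK// fin_num_measure.
(* [integral_split_range] wants nonnegative integrands for every [y], hence the
   absolute value. *)
pose b' (y : R) i := if i == m then `|y| else b i.
have b'0 y i : 0 <= b' y i by rewrite /b'; case: ifP.
have cS i w : c m.+1 b i w = c m (b' (C m w)) i w.
  rewrite /c ltnS /b'; case: ltngtP => // ->.
  by rewrite ger0_norm.
have uS w : u m.+1 b w = u m (b' (C m w)) w.
  by apply: eq_bigr => i _; rewrite cS.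
have vS w : v m.+1 b w = v m (b' (C m w)) w.
  by apply: eq_bigr => i _; rewrite cS.
under eq_integral do rewrite uS.
under [RHS]eq_integral do rewrite vS.
rewrite (integral_split_range P (C m) A (fun y => u m (b' y)))//; last exact: mH.
rewrite (integral_split_range P (C m) A (fun y => v m (b' y)))//; first last.
- by move=> y w; exact: v0.
- by move=> y; exact: mv.
- exact: mH.
apply: eq_fsbigr => y _; apply: IH => //; first exact: ltnW.
exact: HI.
Qed.

(** The random number of points is one more conditioning variable: each event [N = n] lies in [H]
    and plays the role of [E] above. *)
Lemma integral_expR_marked_sum (N : T -> nat) (F C : nat -> T -> R) :
  measurable_fun setT N ->
  (forall i, measurable_fun setT (F i)) ->
  (forall i (b : R), (0 <= b)%R ->
     \int[P]_w (expR (- (b * F i w)))%:E = ((1 + b)^-1)%:E)%E ->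
  (forall M A (K : nat -> set R), H A -> (forall i, measurable (K i)) ->
     P (A `&` \bigcap_(i in `I_M) F i @^-1` K i)
     = P A * \prod_(i < M) P (F i @^-1` K i))%E ->
  (forall n, H (N @^-1` [set n])) ->
  (forall i, measurable_fun setT (C i)) -> (forall i w, 0 <= C i w) ->
  (forall i, finite_set (range (C i))) ->
  (forall i y, H (C i @^-1` [set y])) ->
  (\int[P]_w (\prod_(i < N w) expR (- (C i w * F i w)))%:E
   = \int[P]_w (\prod_(i < N w) (1 + C i w)^-1)%:E)%E.
Proof.
move=> mN mF FE FK HN mC C0 finC HC.
rewrite (integral_index P N mN (fun n w => \prod_(i < n) expR (- (C i w * F i w)))).
- rewrite (integral_index P N mN (fun n w => \prod_(i < n) (1 + C i w)^-1)).
  + by apply: eq_eseriesr => n _; apply: integral_expR_marks => //; exact: FK.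
  + by move=> n; apply: measurable_prod => i _; apply: measurable_inv1D.
  + by move=> n w; apply: prodr_ge0 => i _; rewrite invr_ge0 addr_ge0.
- move=> n; apply: measurable_prod => i _; apply: measurableT_comp => //.
  by apply: measurableT_comp => //; exact: measurable_funM.
- by move=> n w; apply: prodr_ge0 => i _; exact: expR_ge0.
Qed.
End Marks.

(** * Products over the points of a Poisson process *)

Section Poisson.
Context {d : measure_display} {T : measurableType d} {R : realType}.
Variable P : probability T R.

Lemma poisson_prob_set1 (r : R) (k n : nat) : 0 <= r ->
  poisson_prob r k [set n] = (expR (- r) * (r ^+ n / n`!%:R))%:E.
Proof.
rewrite le_eqVlt => /predU1P[<-|r0]; rewrite /poisson_prob.
  (* At rate [0] the law is the Dirac mass at [0], and the formula agrees with it because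
     [0 ^+ 0 = 1]. *)
  rewrite ltxx diracE oppr0 expR0 mul1r; case: n => [|n].
    by rewrite mem_set// expr0 fact0 divr1.
  by rewrite memNset// expr0n mul0r.
by rewrite r0 esum_set1 /poisson_pmf ?r0 ?lee_fin 1?mulrC// mulr_ge0 ?divr_ge0 ?expR_ge0// exprn_ge0// ltW.
Qed.

(** The probability generating function of a Poisson variable, summed as the exponential series of
    [r * q]. *)
Lemma integral_expn_poisson (X : T -> nat) (r q : R) :
  measurable_fun setT X -> 0 <= r -> 0 <= q ->
  (forall K, P (X @^-1` K) = poisson_prob r 0 K) ->
  (\int[P]_w (q ^+ X w)%:E = (expR (- (r * (1 - q))))%:E)%E.
Proof.
move=> mX r0 q0 XP.
rewrite (integral_index P X mX (fun n _ => q ^+ n))//=; last first.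
  by move=> n w; rewrite exprn_ge0.
have -> : - (r * (1 - q)) = - r + r * q by ring.
rewrite expRD EFinM.
transitivity (\sum_(n <oo) (expR (- r))%:E * ((r * q) ^+ n / n`!%:R)%:E)%E.
  apply: eq_eseriesr => n _.
  have mXn : measurable (X @^-1` [set n]).
    by rewrite -[X in measurable X]setTI; apply: mX.
  under eq_integral do rewrite mulrC EFinM.
  rewrite ge0_integralZl_EFin//; last 2 first.
  - exact/measurable_EFinP.
  - by rewrite exprn_ge0.
  rewrite integral_indic// setIT.
  transitivity ((q ^+ n)%:E * poisson_prob r 0 [set n])%E.
    by congr (_ * _)%E; exact: XP.
  rewrite poisson_prob_set1// -!EFinM exprMn.
  by congr EFin; ring.
rewrite nneseriesZl/=; last first.
  by move=> n _; rewrite lee_fin divr_ge0// exprn_ge0// mulr_ge0.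
congr *%E.
rewrite expRE -EFin_lim; last first.
  rewrite /pseries/=; under eq_fun do rewrite mulrC.
  exact: is_cvg_series_exp_coeff.
apply/congr_lim/funext => n/=; rewrite /pseries/= /series/= -sumEFin//.
by under eq_bigr do rewrite mulrC.
Qed.

(** Equal factors are grouped, so that the product over the points depends only on the numbers of
    points in the level sets of [q]. *)
Lemma prod_finite_values (q : R -> R) (a s : seq R) :
  uniq a -> {in s, forall y, q y \in a} ->
  \prod_(y <- s) q y
  = \prod_(i < size a) a`_i ^+ count (fun y => q y == a`_i) s.
Proof.
move=> ua sa.
transitivity (\prod_(y <- s) \prod_(v <- a | v == q y) v).
  apply: eq_big_seq => y /sa qa.
  by rewrite -big_filter filter_pred1_uniq// big_seq1.
rewrite (exchange_big_dep xpredT)//= (big_nth 0) big_mkord.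
apply: eq_bigr => i _; rewrite big_const_seq -Monoid.iteropE.
by congr (_ ^+ _); apply: eq_count => y; rewrite eq_sym.
Qed.

Lemma npoints_count (Psi : T -> set R) (q : R -> R) (B : set R) (v : R) w :
  finite_set (Psi w) -> Psi w `<=` B ->
  npoints Psi (B `&` q @^-1` [set v]) w
  = count (fun y => q y == v) (fset_set (Psi w)).
Proof.
move=> fin PB; rewrite /npoints -size_filter.
apply/perm_size/uniq_perm => [||y]; rewrite ?filter_uniq//.
rewrite in_fset_set; last exact: finite_setIl.
rewrite mem_filter in_fset_set//; apply/idP/idP.
  move=> /set_mem[yP [_ qv]]; apply/andP; split; [exact/eqP|exact/mem_set].
move=> /andP[/eqP qv /set_mem yP]; apply/mem_set; split=> //; split=> //.
exact: PB.
Qed.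

(** The level sets of [q] in [B] are disjoint, so their counts are independent Poisson variables.
    The expectation is the product of their generating functions at the values of [q], and the
    exponents add up to the integral of [1 - q] over [B]. *)
Lemma integral_prod_ppp (lam : R) (B : set R) (Psi : T -> set R)
    (q : R -> R) :
  0 <= lam -> measurable B -> (lebesgue_measure B < +oo)%E ->
  homogeneous_ppp P lam B Psi ->
  measurable_fun setT q -> finite_set (range q) -> (forall y, 0 <= q y <= 1) ->
  (\int[P]_w (\prod_(y <- fset_set (Psi w)) q y)%:E
   = (expR (- (lam * \int[lebesgue_measure]_(y in B) (1 - q y))))%:E)%E.
Proof.
move=> lam0 mB Bfin [PsiB mPsi PsiP PsiI] mq finq q01.
pose a : seq R := fset_set (range q).
(* Independence of the counts is stated for infinite sequences of disjoint sets, hence the padding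
   by empty sets. *)
pose A_ i := if (i < size a)%N then B `&` q @^-1` [set a`_i] else set0.
have mA i : measurable (A_ i).
  rewrite /A_; case: ifP => // _; apply: measurableI => //.
  by rewrite -[X in measurable X]setTI; apply: mq.
have AB i : A_ i `<=` B by rewrite /A_; case: ifP => // _ y [].
have Afin i : (lebesgue_measure (A_ i) < +oo)%E.
  apply: le_lt_trans Bfin; apply: le_measure; last exact: AB.
  - by rewrite inE; exact: mA.
  - by rewrite inE; exact: mB.
have ua : uniq a by exact: fset_uniq.
have qa y : q y \in a by rewrite /a in_fset_set// inE; exists y.
have a01 i : 0 <= a`_i <= 1.
  have [ia|ia] := ltnP i (size a); last by rewrite nth_default// lexx ler01.
  have := mem_nth 0 ia; rewrite {1}/a in_fset_set// inE => -[y _ <-].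
  exact: q01.
have a0 i : 0 <= a`_i by case/andP: (a01 i).
have tA : trivIset setT A_.
  apply/trivIsetP => i j _ _ ij; rewrite /A_.
  case: ifP => ia; last by rewrite set0I.
  case: ifP => ja; last by rewrite setI0.
  rewrite -subset0 => y [[_ /= qi] [_ /= qj]].
  by move: ij; rewrite -(nth_uniq 0 ia ja ua) -qi -qj eqxx.
have mN i : measurable_fun setT (npoints Psi (A_ i)) by exact: mPsi.
pose r i := lam * fine (lebesgue_measure (A_ i)).
have r0 i : 0 <= r i by rewrite mulr_ge0// fine_ge0.
transitivity (\int[P]_w (cst 1 w * \prod_(i < size a)
    a`_i ^+ npoints Psi (A_ i) w)%:E)%E.
  apply: eq_integral => w _; rewrite mul1r; congr EFin.
  rewrite (prod_finite_values q a)//; apply: eq_bigr => i _.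
  have [PB Pfin] := PsiB w.
  by rewrite /A_ ltn_ord npoints_count.
rewrite (@integral_prod_comp _ _ _ P _ _ (size a) (fun i => npoints Psi (A_ i))
  (fun i n => a`_i ^+ n) (fun i => expR (- (r i * (1 - a`_i)))) (cst 1) 1)//=.
- rewrite mul1r -expR_sum sumrN; congr (expR (- _))%:E.
  (* The absolute value changes nothing since [q <= 1]; it meets the nonnegativity condition of
     [integral_split_range], which ranges over all reals and not only over values of [q]. *)
  have -> : (\int[lebesgue_measure]_(y in B) (1 - q y)
      = fine (\int[lebesgue_measure]_y (\1_B y * `|1 - q y|)%:E))%R.
    rewrite /Rintegral [in LHS]integral_mkcond; congr fine.
    apply: eq_integral => y _; rewrite patchE indicE; case: ifP => _.
      by rewrite mul1r ger0_norm// subr_ge0; case/andP: (q01 y).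
    by rewrite mul0r.
  rewrite (integral_split_range lebesgue_measure q B (fun v _ => `|1 - v|))//.
  rewrite fsbig_finite//= -/a (big_nth 0) big_mkord.
  rewrite (eq_bigr (fun i : 'I_(size a) =>
    ((1 - a`_i) * fine (lebesgue_measure (A_ i)))%:E)); last first.
    move=> i _; under eq_integral do rewrite mulrC EFinM.
    rewrite ge0_integralZl_EFin//; last first.
      apply/measurable_EFinP/measurable_indic.
      by have := mA i; rewrite /A_ ltn_ord.
    rewrite integral_indic//; last by have := mA i; rewrite /A_ ltn_ord.
    rewrite setIT ger0_norm ?subr_ge0; last by case/andP: (a01 i).
    rewrite EFinM fineK; last by rewrite ge0_fin_numE.
    by rewrite /A_ ltn_ord.
  rewrite sumEFin/= mulr_sumr; apply: eq_bigr => i _.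
  by rewrite /r -mulrA; congr (_ * _); rewrite mulrC.
- by move=> i n; rewrite exprn_ge0.
- move=> i ia; apply: integral_expn_poisson => // K.
  by rewrite PsiP//; exact: AB.
- move=> K mK; rewrite mul1e.
  under eq_integral do rewrite mul1r (prod_indicE _ (fun i => npoints Psi (A_ i)) K).
  rewrite integral_indic ?setIT//; last first.
    apply: bigcap_measurableType => i _.
    by rewrite -[X in measurable X]setTI; apply: mN.
  apply: (mutually_independent_bigcap P (fun i => npoints Psi (A_ i))) => //.
  exact: PsiI.
Qed.
End Poisson.

(** * The Laplace functional of the marked Poisson process *)

Section Laplace.
Context {d : measure_display} {T : measurableType d} {R : realType}.
Variable P : probability T R.
Import HBNNSimple.

(** Marks are attached to the enumeration, the Poisson law to the random set; this passes from one
    description to the other. The operation is abstract because both sums and products occur. *)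
Lemma big_points {I} {idx : I} (op : Monoid.com_law idx) (Psi : T -> set R)
    (N : T -> nat) (Y : nat -> T -> R) (G : R -> I) w :
  Psi w = [set Y n w | n in [set n | (n < N w)%N]] ->
  (forall m n, (m < N w)%N -> (n < N w)%N -> Y m w = Y n w -> m = n) ->
  \big[op/idx]_(y <- fset_set (Psi w)) G y
  = \big[op/idx]_(i < N w) G (Y i w).
Proof.
move=> PsiE Yinj.
have fin : finite_set (Psi w) by rewrite PsiE; apply: finite_image; exact: finite_II.
rewrite (perm_big [seq Y i w | i <- index_iota 0 (N w)]).
  by rewrite big_map big_mkord.
apply: uniq_perm; first exact: fset_uniq.
  rewrite map_inj_in_uniq ?iota_uniq// => m n.
  by rewrite !mem_index_iota => mN nN; exact: Yinj.
move=> y; rewrite in_fset_set//; apply/idP/mapP => [/set_mem|[n]].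
  by rewrite PsiE => -[n /= nN <-]; exists n; rewrite ?mem_index_iota.
by rewrite mem_index_iota => nN ->; rewrite PsiE; apply/mem_set; exists n.
Qed.

(** A mark may be negative on a null set. Almost sure nonnegativity is what bounds the exponential
    of minus the interference by [1] in the dominated convergence below. *)
Lemma exponential_ae_ge0 (F : {RV P >-> R}) :
  (forall K, measurable K -> distribution P F K = exponential_prob 1 K) ->
  \forall w \ae P, 0 <= F w.
Proof.
move=> FE; exists (F @^-1` `]-oo, 0[%classic); split.
- exact: measurable_funPTI.
- rewrite -[LHS]/(distribution P F `]-oo, 0[%classic) FE//.
  apply: integral0_eq => x; rewrite /= in_itv/= => x0.
  by rewrite lt0_exponential_pdf.
- by move=> w /= /negP; rewrite -ltNge in_itv.
Qed.

Variables (lam : R) (B : set R) (Psi : T -> set R) (lf : T -> R -> R).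
Hypothesis lam0 : 0 <= lam.
Hypothesis mB : measurable B.
Hypothesis Bfin : (lebesgue_measure B < +oo)%E.
Hypothesis ppp : homogeneous_ppp P lam B Psi.

(** The marks are integrated out first, which leaves the product of [1 / (1 + s y)] over the points.
    The finite range of [s] serves twice: for conditioning on the attenuations and for grouping the
    points into level sets. *)
Lemma laplace_marked_ppp_simple (s : {nnsfun R >-> R}) :
  iid_exp1_marks P Psi lf ->
  (\int[P]_w (expR (- \sum_(y <- fset_set (Psi w)) lf w y * s y))%:E
   = (expR (- (lam * \int[lebesgue_measure]_(y in B) (1 - (1 + s y)^-1))))%:E)%E.
Proof.
move=> [N [Y [F [PsiE Yinj lfE [FE indF] indFNY]]]].
set H := <<s sigma_of N `|` \bigcup_n sigma_of (Y n) >> in indFNY.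
have HI : setI_closed H.
  by move=> A A' HA HA'; apply: (@measurableI _ (g_sigma_algebraType _)).
have HN n : H (N @^-1` [set n]).
  apply: sub_sigma_algebra; left; exists [set n] => //; exact: setTI.
have HY n K : measurable K -> H (Y n @^-1` K).
  by move=> mK; apply: sub_sigma_algebra; right; exists n => //; exists K => //; exact: setTI.
have mH : H `<=` measurable.
  apply: smallest_sub; first exact: sigma_algebra_measurable.
  rewrite subUset; split=> [A [K mK <-]|A [n _ [K mK <-]]].
    by rewrite setTI; exact: measurable_funPTI.
  by rewrite setTI; exact: measurable_funPTI.
have mN : measurable_fun setT N by exact: measurable_funPT.
have mF i : measurable_fun setT (F i) by exact: measurable_funPT.
have mY i : measurable_fun setT (Y i) by exact: measurable_funPT.
have FK M A (K : nat -> set R) : H A -> (forall i, measurable (K i)) ->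
   (P (A `&` \bigcap_(i in `I_M) F i @^-1` K i)
    = P A * \prod_(i < M) P (F i @^-1` K i))%E.
  move=> HA mK; rewrite setIC indFNY//.
    rewrite muleC; congr (_ * _)%E.
    exact: (mutually_independent_bigcap P F).
  apply: (@bigcap_measurableType _ (g_sigma_algebraType _)) => i _.
  by apply: sub_sigma_algebra; exists i => //; exists (K i) => //; exact: setTI.
transitivity (\int[P]_w
    (\prod_(i < N w) expR (- (s (Y i w) * F i w)))%:E)%E.
  apply: eq_integral => w _; congr EFin.
  rewrite -expR_sum sumrN; congr (expR (- _)).
  rewrite (big_points _ Psi N Y)//; last exact: Yinj.
  by apply: eq_bigr => i _; rewrite lfE// mulrC.
rewrite (integral_expR_marked_sum P H HI mH N F (fun i w => s (Y i w)))//.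
- rewrite -(integral_prod_ppp P lam B Psi (fun y => (1 + s y)^-1))//.
  + apply: eq_integral => w _; rewrite (big_points _ Psi N Y)//.
    exact: Yinj.
  + exact: measurable_inv1D.
  + have -> : (fun y => (1 + s y)^-1) = (fun x => (1 + x)^-1) \o s by [].
    by rewrite -image_comp; exact: finite_image.
  + move=> y; rewrite invr_ge0 addr_ge0//=.
    by rewrite invf_le1 ?lerDl// ltr_wpDr.
- by move=> i b b0; apply: integral_expR_exponential => //; exact: FE.
- by move=> i; exact: measurableT_comp.
- move=> i; apply: (@sub_finite_set _ _ (range s)) => //.
  by move=> _ [w _ <-]; exists (Y i w).
- by move=> i y; apply: (HY i (s @^-1` [set y])); exact: measurable_funPTI.
Qed.

(** Both sides pass to the limit along simple functions increasing to [s]. The constant [1]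
    dominates on each side: on the left [P] is a probability, on the right [B] has finite
    measure. *)
Lemma laplace_marked_ppp (s : R -> R) :
  iid_exp1_marks P Psi lf ->
  measurable_fun setT s -> (forall y, 0 <= s y) ->
  (\int[P]_w (expR (- \sum_(y <- fset_set (Psi w)) lf w y * s y))%:E
   = (expR (- (lam * \int[lebesgue_measure]_(y in B) (1 - (1 + s y)^-1))))%:E)%E.
Proof.
move=> marks ms s0.
have mEs : measurable_fun setT (fun y => (s y)%:E) by exact/measurable_EFinP.
pose h := nnsfun_approx measurableT mEs.
have hs y : h n y @[n --> \oo] --> s y.
  have : (h n y)%:E @[n --> \oo] --> (s y)%:E.
    by apply: (cvg_nnsfun_approx measurableT mEs) => //= z _; rewrite lee_fin.
  by move/fine_cvg.
have [N [Y [F [PsiE Yinj lfE [FE indF] indFNY]]]] := marks.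
have mN : measurable_fun setT N by exact: measurable_funPT.
have mF i : measurable_fun setT (F i) by exact: measurable_funPT.
have mY i : measurable_fun setT (Y i) by exact: measurable_funPT.
have sumE (f : R -> R) w : \sum_(y <- fset_set (Psi w)) lf w y * f y
    = \sum_(i < N w) F i w * f (Y i w).
  rewrite (big_points _ Psi N Y)//; last exact: Yinj.
  by apply: eq_bigr => i _; rewrite lfE.
(* A sum over a random set has no evident measurability; rewritten through the enumeration, it is a
   finite sum of measurable functions with random length [N]. *)
have mI (f : R -> R) : measurable_fun setT f ->
    measurable_fun setT (fun w => (expR (- \sum_(y <- fset_set (Psi w)) lf w y * f y))%:E).
  move=> mf; apply/measurable_EFinP; apply: measurableT_comp => //.
  apply: measurableT_comp => //; under eq_fun do rewrite sumE.
  apply: (measurable_fun_index N mN (fun n w => \sum_(i < n) F i w * f (Y i w))) => n.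
  by apply: measurable_sum => i; apply: measurable_funM => //; exact: measurableT_comp.
have L : (\int[P]_w (expR (- \sum_(y <- fset_set (Psi w)) lf w y * h n y))%:E
    @[n --> \oo] -->
    \int[P]_w (expR (- \sum_(y <- fset_set (Psi w)) lf w y * s y))%:E)%E.
  have [] // := @dominated_convergence _ _ _ P setT measurableT
    (fun n w => (expR (- \sum_(y <- fset_set (Psi w)) lf w y * h n y))%:E)
    (fun w => (expR (- \sum_(y <- fset_set (Psi w)) lf w y * s y))%:E)
    (cst 1%E).
  - by move=> n; apply: mI.
  - exact: mI.
  - apply: aeW => w _; apply: cvg_EFin; first exact: nearW.
    apply: (continuous_cvg _ (@continuous_expR R _)).
    apply: cvgN; apply: (cvg_big (@add_continuous _)) => y _.
    by apply: cvgMl_tmp; exact: hs.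
  - exact: finite_measure_integrable_cst.
  - have : \forall w \ae P, forall i, 0 <= F i w.
      by apply: ae_foralln => i; apply: exponential_ae_ge0; exact: FE.
    apply: filterS => w F0 n _; rewrite lee_fin ger0_norm ?expR_ge0//.
    rewrite -[leRHS]expR0 ler_expR oppr_le0 sumE.
    by apply: sumr_ge0 => i _; rewrite mulr_ge0.
have Rt : (\int[lebesgue_measure]_(y in B) (1 - (1 + h n y)^-1) @[n --> \oo]
    --> \int[lebesgue_measure]_(y in B) (1 - (1 + s y)^-1))%R.
  have m1 (f : R -> R) : measurable_fun setT f -> (forall y, 0 <= f y) ->
      measurable_fun B (fun y => (1 - (1 + f y)^-1)%:E).
    move=> mf f0; apply/measurable_EFinP/measurable_funTS.
    by apply: measurable_funB => //; exact: measurable_inv1D.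
  have int1 : lebesgue_measure.-integrable B (cst 1%E).
    apply/integrableP; split; first exact: measurable_cst.
    by under eq_integral do rewrite /= normr1; rewrite integral_cst// mul1e.
  have [ | | | | |is1 _ C] := @dominated_convergence _ _ _ lebesgue_measure B mB
    (fun n y => (1 - (1 + h n y)^-1)%:E) (fun y => (1 - (1 + s y)^-1)%:E)
    (cst 1%E).
  - by move=> n; apply: m1.
  - exact: m1.
  - apply: aeW => y _; apply: cvg_EFin; first exact: nearW.
    apply: cvgB; first exact: cvg_cst.
    apply: cvgV; first by rewrite gt_eqF// ltr_wpDr.
    by apply: cvgD; [exact: cvg_cst|exact: hs].
  - exact: int1.
  - apply: aeW => y n _; rewrite lee_fin.
    have h0 : 0 <= h n y by [].
    have i0 : 0 <= (1 + h n y)^-1 by rewrite invr_ge0 addr_ge0.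
    have i1 : (1 + h n y)^-1 <= 1 by rewrite invf_le1 ?lerDl// ltr_wpDr.
    by rewrite ger0_norm; lra.
  apply: fine_cvg; rewrite fineK; last exact: integrable_fin_num.
  exact: C.
apply: (cvg_unique (@ereal_hausdorff R) L).
rewrite (eq_fun (fun n => laplace_marked_ppp_simple (h n) marks)).
apply: cvg_EFin; first exact: nearW.
apply: (continuous_cvg _ (@continuous_expR R _)).
apply: cvgN; exact: cvgMl_tmp.
Qed.
End Laplace.

(** * Integrals of the path gain along the road *)

Section Road.
Context {R : realType}.
Variable alpha : R.
Hypothesis alpha1 : 1 < alpha.
Local Notation mu := (@lebesgue_measure R).

Let alpha0 : 0 < alpha.
Proof. exact: lt_trans alpha1. Qed.

(* The absolute value makes this function continuous on the whole line:
   [u `^ alpha] is [1] for [u < 0]. *)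
Definition path_gain (u : R) : R := (1 + `|u| `^ alpha)^-1.

Lemma path_gain_gt0 u : 0 < path_gain u.
Proof. by rewrite invr_gt0 ltr_wpDr// powR_ge0. Qed.

Lemma continuous_path_gain : continuous path_gain.
Proof.
move=> x; apply: cvgV; first by rewrite gt_eqF// ltr_wpDr// powR_ge0.
apply: cvgD; first exact: cvg_cst.
(* Differentiability of the power is available at positive points only. At [0] continuity is checked
   directly, with radius [e] to the power [1 / alpha]. *)
have [->|x0] := eqVneq x 0.
  rewrite normr0 powR0 ?gt_eqF//; apply/cvgr0Pnorm_lt => e e0.
  near=> u; rewrite ger0_norm ?powR_ge0//.
  have eE : e = (e `^ alpha^-1) `^ alpha.
    by rewrite -powRrM mulVf ?gt_eqF// powRr1// ltW.
  rewrite eE; apply: gt0_ltr_powR => //; rewrite ?nnegrE ?powR_ge0//.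
  near: u; apply/(cvgr0Pnorm_lt _).1; last by rewrite powR_gt0.
  exact: cvg_id.
have : derivable (fun u : R => u `^ alpha) `|x| 1.
  by apply: derivable_powR; rewrite in_itv/= andbT normr_gt0.
move=> /derivable1_diffP/differentiable_continuous pc.
exact: (continuous_cvg _ (h := fun u : R => u `^ alpha) pc (@norm_continuous _ R x)).
Unshelve. all: by end_near. Qed.

Lemma measurable_path_gain : measurable_fun setT path_gain.
Proof. by apply: continuous_measurable_fun; exact: continuous_path_gain. Qed.

Lemma integral_path_gain (a b : R) : 0 <= a -> a <= b ->
  (\int[mu]_(u in `[a, b]) (path_gain u)%:E
   = (g_circ alpha b - g_circ alpha a)%:E)%E.
Proof.
move=> a0; rewrite le_eqVlt => /predU1P[->|ab].
  by rewrite set_itv1 integral_set1 subrr.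
have b0 : 0 < b by exact: le_lt_trans ab.
have ib : mu.-integrable `[0, b] (EFin \o path_gain).
  apply: continuous_compact_integrable; first exact: segment_compact.
  by apply: continuous_subspaceT; exact: continuous_path_gain.
have iab : mu.-integrable `[a, b] (EFin \o path_gain).
  apply: continuous_compact_integrable; first exact: segment_compact.
  by apply: continuous_subspaceT; exact: continuous_path_gain.
rewrite -[LHS]fineK; last exact: integrable_fin_num.
congr EFin.
have gE t : g_circ alpha t = (\int[mu]_(u in `[0, t]) path_gain u)%R.
  apply: eq_Rintegral => u; rewrite inE/= in_itv/= => /andP[u0 _].
  by rewrite /path_gain ger0_norm.
rewrite !gE.
rewrite -[LHS]/(\int[mu]_(u in `[a, b]) path_gain u)%R.
rewrite (Rintegral_itvB ib)//.
  rewrite Rintegral_itv_obnd_cbnd//.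
  by apply: integrableS iab => //; exact: subset_itv_oc_cc.
by rewrite bnd_simp ltW.
Qed.

Lemma integral_affine_path_gain (a b c e : R) :
  0 <= a -> a <= b -> 0 < c -> 0 <= e ->
  (\int[mu]_(y in `[a, b]) (path_gain (c * y + e))%:E
   = (c^-1 * (g_circ alpha (c * b + e) - g_circ alpha (c * a + e)))%:E)%E.
Proof.
move=> a0 + c0 e0; rewrite le_eqVlt => /predU1P[->|ab].
  by rewrite set_itv1 integral_set1 subrr mulr0.
pose F (y : R) : R := c * y + e.
have Fab : F a < F b by rewrite ltrD2r ltr_pM2l.
have Fa0 : 0 <= F a by rewrite addr_ge0// mulr_ge0// ltW.
have dF x : is_derive x (1 : R) F c.
  rewrite /F; apply: is_derive_eq.
  by rewrite /GRing.scale/= mulr1 ?mulr0 ?scale0r ?addr0 ?add0r.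
have DF : derive1 F = cst c by apply/funext => y; rewrite derive1E derive_val.
have cF : continuous F.
  by move=> y; apply: cvgD; [apply: cvgMl_tmp; exact: cvg_id|exact: cvg_cst].
have sub : (\int[mu]_(y in `[a, b]) (((path_gain \o F) * derive1 F) y)%:E
    = (g_circ alpha (F b) - g_circ alpha (F a))%:E)%E.
  rewrite -integration_by_substitution_increasing//.
  - by rewrite integral_path_gain//; exact: ltW.
  - exact: ltW.
  - by move=> x y _ _ xy; rewrite ltrD2r ltr_pM2l.
  - by rewrite DF => x _; exact: cvg_cst.
  - by rewrite DF; exact: is_cvg_cst.
  - by rewrite DF; exact: is_cvg_cst.
  - split.
    + by move=> x _; apply: ex_derive.
    + by apply: cvg_at_right_filter; exact: cF.
    + by apply: cvg_at_left_filter; exact: cF.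
  - by apply: continuous_subspaceT; exact: continuous_path_gain.
rewrite EFinM -sub -ge0_integralZl_EFin//.
- apply: eq_integral => y _; rewrite DF -EFinM; congr EFin.
  by rewrite /= mulrCA mulVf ?gt_eqF// mulr1.
- move=> y _; rewrite DF lee_fin; apply: mulr_ge0; last exact: ltW.
  exact/ltW/path_gain_gt0.
- apply/measurable_EFinP/measurable_funTS; rewrite DF.
  apply: measurable_funM => //; apply: measurableT_comp; first exact: measurable_path_gain.
  exact: continuous_measurable_fun.
- by rewrite invr_ge0 ltW.
Qed.

Lemma integral_affine_path_gainN (a b c e : R) :
  0 <= a -> a <= b -> 0 < c -> 0 <= e ->
  (\int[mu]_(y in `[(- b)%R, (- a)%R]) (path_gain (c * - y + e))%:E
   = (c^-1 * (g_circ alpha (c * b + e) - g_circ alpha (c * a + e)))%:E)%E.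
Proof.
move=> a0 ab c0 e0; rewrite integration_by_substitution_oppr//.
  rewrite -integral_affine_path_gain//.
  by apply: eq_integral => y _ /=; rewrite opprK.
apply: continuous_subspaceT => y.
apply: (continuous_comp (f := fun y => c * - y + e)); last exact: continuous_path_gain.
by apply: cvgD; [apply: cvgMl_tmp; apply: cvgN; exact: cvg_id|exact: cvg_cst].
Qed.

(** The two halves of the annulus are mirror images. The points [|y| = a] are left out because [E]
    may follow another formula there: this happens at the origin and at the break-point. *)
Lemma integral_annulus (E : R -> R) (a b c e : R) :
  measurable_fun setT E ->
  0 <= a -> a <= b -> 0 < c -> 0 <= e ->
  (forall y, a < `|y| <= b -> E y = path_gain (c * `|y| + e)) ->
  let G := (c^-1 * (g_circ alpha (c * b + e) - g_circ alpha (c * a + e)))%:E in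
  (\int[mu]_(y in `]a, b]) (E y)%:E = G /\
   \int[mu]_(y in `[(- b)%R, (- a)%R[) (E y)%:E = G)%E.
Proof.
move=> mE a0 ab c0 e0 Ey G.
have mEE D : measurable_fun D (fun y => (E y)%:E).
  by apply/measurable_EFinP/measurable_funTS.
have mg D (f : R -> R) : continuous f ->
    measurable_fun D (fun y => (path_gain (f y))%:E).
  move=> cf; apply/measurable_EFinP/measurable_funTS.
  apply: measurableT_comp; first exact: measurable_path_gain.
  exact: continuous_measurable_fun.
split.
- rewrite /G -integral_affine_path_gain//.
  rewrite -[RHS]integral_itv_obnd_cbnd; last first.
    apply: (mg _ (fun y => c * y + e)) => y.
    by apply: cvgD; [apply: cvgMl_tmp; exact: cvg_id|exact: cvg_cst].
  apply: eq_integral => y; rewrite inE/= in_itv/= => /andP[ay yb].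
  have y0 : 0 < y by exact: le_lt_trans ay.
  by rewrite Ey gtr0_norm// ay.
- rewrite /G -integral_affine_path_gainN//.
  rewrite -[RHS]integral_itv_bndo_bndc; last first.
    apply: (mg _ (fun y => c * - y + e)) => y.
    by apply: cvgD; [apply: cvgMl_tmp; apply: cvgN; exact: cvg_id|exact: cvg_cst].
  apply: eq_integral => y; rewrite inE/= in_itv/= => /andP[yb ya].
  have y0 : y < 0 by apply: (lt_le_trans ya); rewrite oppr_le0.
  by rewrite Ey ltr0_norm// ltrNr ya lerNl.
Qed.

Lemma ge0_integral_itv_cut (E : R -> R) (a b c : itv_bound R) :
  measurable_fun setT E -> (forall y, 0 <= E y) -> (a <= b)%O -> (b <= c)%O ->
  (\int[mu]_(y in [set` Interval a c]) (E y)%:E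
   = \int[mu]_(y in [set` Interval a b]) (E y)%:E
     + \int[mu]_(y in [set` Interval b c]) (E y)%:E)%E.
Proof.
move=> mE E0 ab bc; rewrite (itv_bndbnd_setU ab bc) ge0_integral_setU//=.
- by apply/measurable_EFinP/measurable_funTS.
- by move=> y _; rewrite lee_fin.
- apply/disj_setPS => y [/=]; rewrite !itv_boundlr => /andP[_ yb] /andP[by' _].
  by have := le_trans yb by'; rewrite bnd_simp ltxx.
Qed.

(** The road splits into the annuli [0 < |y| <= tri] and [tri < |y| <= Ry], and on each the argument
    of [path_gain] is affine in [|y|]. The origin is a null set and has to be excluded: for [r = 0]
    the path loss takes the default value of a negative power at [0]. *)
Lemma integral_path_gain_road (E : R -> R) (tri r z k Ry : R) :
  measurable_fun setT E -> (forall y, 0 <= E y) ->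
  0 < tri -> tri <= Ry -> 0 <= r -> 0 < z -> (tri < r -> 0 < k) ->
  (forall y, y != 0 -> E y =
     if tri < Num.min `|y| r then path_gain (k * `|y| / z)
     else path_gain ((`|y| + r) / z)) ->
  \int[mu]_(y in [set y | `|y| <= Ry]) E y = z * calY alpha tri r z k Ry.
Proof.
move=> mE E0 tri0 triR r0 z0 k0 Ey.
have zV0 : 0 < z^-1 by rewrite invr_gt0.
have Ein y : 0 < `|y| <= tri -> E y = path_gain (z^-1 * `|y| + r / z).
  move=> /andP[y0 yt]; rewrite Ey -?normr_gt0// lt_min ltNge yt/=.
  by rewrite mulrDl [z^-1 * _]mulrC.
have [p1 n1] := integral_annulus E 0 tri z^-1 (r / z) mE (lexx 0) (ltW tri0)
  zV0 (divr_ge0 r0 (ltW z0)) Ein.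
(* Slope and intercept on the outer annulus; when [r <= tri] they are those of the inner one. *)
pose c := if tri < r then k / z else z^-1.
pose e := if tri < r then 0 else r / z.
have c0 : 0 < c.
  by rewrite /c; case: ifP => tr; rewrite ?divr_gt0 ?invr_gt0// k0.
have e0 : 0 <= e by rewrite /e; case: ifP => // _; rewrite divr_ge0// ltW.
have Eout y : tri < `|y| <= Ry -> E y = path_gain (c * `|y| + e).
  move=> /andP[ty yR]; rewrite Ey -?normr_gt0 ?(lt_trans _ ty)//.
  rewrite lt_min ty/= /c /e; case: ifP => _; first by rewrite addr0 mulrAC.
  by rewrite mulrDl [z^-1 * _]mulrC.
have [p2 n2] := integral_annulus E tri Ry c e mE (ltW tri0) triR c0 e0 Eout.
have -> : [set y | `|y| <= Ry] = `[(- Ry)%R, Ry]%classic.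
  by apply/seteqP; split=> y; rewrite /= in_itv/= ler_norml.
rewrite /Rintegral.
have R0 : 0 < Ry by exact: lt_le_trans triR.
(* The sides of the bounds are chosen so that the cuts give [[-Ry, -tri[], [[-tri, 0[], [[0, tri]]
   and []tri, Ry]], which are the pieces of [integral_annulus] up to the origin. *)
have h1 : (BLeft (- Ry) <= BLeft (- tri))%O by rewrite bnd_simp lerN2.
have h2 : (BLeft (- tri) <= BRight Ry)%O by rewrite bnd_simp; lra.
have h3 : (BLeft (- tri) <= BRight tri)%O by rewrite bnd_simp; lra.
have h4 : (BRight tri <= BRight Ry)%O by rewrite bnd_simp.
have h5 : (BLeft (- tri) <= BLeft 0)%O by rewrite bnd_simp; lra.
have h6 : (BLeft 0 <= BRight tri)%O by rewrite bnd_simp ltW.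
rewrite (ge0_integral_itv_cut E _ _ _ mE E0 h1 h2) n2.
rewrite (ge0_integral_itv_cut E _ _ _ mE E0 h3 h4) p2.
rewrite (ge0_integral_itv_cut E _ _ _ mE E0 h5 h6).
rewrite oppr0 in n1.
rewrite n1 -integral_itv_obnd_cbnd; last by apply/measurable_EFinP/measurable_funTS.
rewrite p1 -!EFinD/= /c /e /calY invrK mulr0 add0r ![z^-1 * _]mulrC.
(* If [tri < r], the outer slope [k / z] contributes the factor [z / k]; otherwise the two terms at
   [(tri + r) / z] cancel. *)
have [tr|rt] := ltP tri r.
  rewrite mulr0 mulr1 add0r !addr0 invf_div -!mulrDl.
  rewrite ![k / z * _]mulrAC.
  field.
  by rewrite gt_eqF// k0.
rewrite invrK ![z^-1 * _]mulrC -!mulrDl mulr0 mulr1 addr0.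
ring.
Qed.
End Road.

(** * Points on the two roads and their path loss *)

Section Vectors.
Context {R : realType}.
Implicit Types (a b : R) (x : 'cV[R]_2).

Lemma enormE x : enorm x = Num.sqrt (x 0 0 ^+ 2 + x 1 0 ^+ 2).
Proof.
rewrite /enorm !big_ord_recl big_ord0 addr0.
by congr (Num.sqrt (_ + x _ 0 ^+ 2)); apply/val_inj.
Qed.

Lemma coord_axes a b :
  (a *: e_x + b *: e_y : 'cV[R]_2) 0 0 = a /\ (a *: e_x + b *: e_y : 'cV[R]_2) 1 0 = b.
Proof. by rewrite !mxE/=; split; ring. Qed.

Lemma enorm_e_x a : enorm (a *: e_x : 'cV[R]_2) = `|a|.
Proof.
have [h0 h1] := coord_axes a 0; rewrite scale0r addr0 in h0 h1.
by rewrite enormE h0 h1 expr0n/= addr0 sqrtr_sqr.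
Qed.

Lemma enorm_e_y a : enorm (a *: e_y : 'cV[R]_2) = `|a|.
Proof.
have [h0 h1] := coord_axes 0 a; rewrite scale0r add0r in h0 h1.
by rewrite enormE h0 h1 expr0n/= add0r sqrtr_sqr.
Qed.

Lemma enorm_eq0 x : enorm x = 0 -> x = 0.
Proof.
rewrite enormE => /eqP; rewrite sqrtr_eq0 => h.
have h0 : x 0 0 = 0 by nra.
have h1 : x 1 0 = 0 by nra.
apply/matrixP => i j; rewrite ord1 mxE.
case: (unliftP 0 i) => [k ->|->//]; rewrite -[RHS]h1; congr (x _ _).
by apply/val_inj; rewrite (ord1 k).
Qed.

Lemma scale_e_y_inj : injective (fun y : R => y *: e_y : 'cV[R]_2).
Proof.
move=> a b ab; have [_ ha] := coord_axes 0 a; have [_ hb] := coord_axes 0 b.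
by rewrite -ha -hb /= ab.
Qed.

(** A power is positive as soon as its base is. Beyond the break-point both distances exceed [tri];
    in the other two cases a zero base would make the two points coincide. *)
Lemma lpl_u_gt0 (alpha A A' tri xr xt yt : R) :
  0 < alpha -> 0 < A -> 0 < A' -> 0 < tri -> xt * yt = 0 ->
  xt *: e_x + yt *: e_y <> xr *: e_x :> 'cV[R]_2 ->
  0 < lpl_u alpha A A' tri (xt *: e_x + yt *: e_y) (xr *: e_x).
Proof.
move=> al0 A0 A'0 t0 xy neq; rewrite /lpl_u.
have [-> ->] := coord_axes xt yt; rewrite enorm_e_x.
have [xt0|xt0] := eqVneq xt 0.
  move: neq; rewrite xt0 scale0r add0r enorm_e_y => neq.
  case: ifPn => [|_].
    rewrite lt_min => /andP[ty tx].
    by rewrite mulr_gt0// powR_gt0// mulr_gt0//; exact: lt_trans t0 _.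
  rewrite mulr_gt0// powR_gt0// lt_neqAle addr_ge0// andbT eq_sym.
  apply/eqP => s0.
  have y0 : yt = 0 by apply/normr0_eq0; have := normr_ge0 xr; have := normr_ge0 yt; lra.
  have x0 : xr = 0 by apply/normr0_eq0; have := normr_ge0 xr; have := normr_ge0 yt; lra.
  by apply: neq; rewrite y0 x0 !scale0r.
have y0 : yt = 0 by move/eqP: xy; rewrite mulf_eq0 (negPf xt0) => /eqP.
rewrite mulr_gt0// powR_gt0// lt_neqAle sqrtr_ge0 andbT eq_sym.
apply/eqP => /enorm_eq0 /eqP; rewrite subr_eq0 => /eqP e; exact: neq.
Qed.

Lemma lpl_u_road (alpha A A' tri xr y : R) :
  lpl_u alpha A A' tri (y *: e_y) (xr *: e_x)
  = if tri < Num.min `|y| `|xr| then A' * (`|y| * `|xr|) `^ (- alpha)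
    else A * (`|y| + `|xr|) `^ (- alpha).
Proof.
have [h0 h1] := coord_axes 0 y; rewrite scale0r add0r in h0 h1.
by rewrite /lpl_u h0 h1 eqxx enorm_e_x enorm_e_y.
Qed.

End Vectors.

(** * Specialization to the urban path loss *)

Lemma interferenceE {d} {T : measurableType d} {R : realType}
    (Psi : T -> set R) (lf : T -> 'cV[R]_2 -> R)
    (lpl : 'cV[R]_2 -> 'cV[R]_2 -> R) (x_rx : 'cV[R]_2) (w : T) :
  finite_set (Psi w) ->
  interference (vertical_points Psi) lf lpl x_rx w
  = \sum_(y <- fset_set (Psi w)) lf w (y *: e_y) * lpl (y *: e_y) x_rx.
Proof.
move=> fin; rewrite /interference /vertical_points.
rewrite -fsbig_finite// fsbig_image//.
by move=> a b _ _; exact: scale_e_y_inj.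
Qed.

(** Turns the integrand of the Poisson exponent into that of [g_circ]. At [v = 0] it fails: the
    negative power is [0] by default, so the left side is [0] and the right side [1]. *)
Lemma sub_inv1D_powRN {R : realType} (alpha v : R) : 0 < v ->
  1 - (1 + v `^ (- alpha))^-1 = path_gain alpha v.
Proof.
move=> v0; rewrite /path_gain gtr0_norm// powRN.
have p0 : 0 < v `^ alpha by exact: powR_gt0.
field.
by apply/andP; split; rewrite gt_eqF// ltr_wpDr// ?ltW.
Qed.

Theorem proposition4 (R : realType) (d : measure_display) (T : measurableType d)
    (P : probability T R)
    (alpha beta A A' tri Ry lambda_y pI : R) (xr xt yt : R)
    (Psi : T -> set R) (lf : T -> 'cV[R]_2 -> R) :
  1 < alpha -> 0 < beta -> 0 < A -> 0 < A' -> 0 < tri -> tri <= Ry ->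
  0 < lambda_y -> 0 <= pI <= 1 ->
  let x_rx : 'cV[R]_2 := xr *: e_x in
  let x_tx : 'cV[R]_2 := xt *: e_x + yt *: e_y in
  xt * yt = 0 -> x_tx <> x_rx ->
  homogeneous_ppp P (pI * lambda_y) [set y | `|y| <= Ry] Psi ->
  iid_exp1_marks P Psi (fun w y => lf w (y *: e_y)) ->
  let zeta := zeta_u alpha beta A A' tri x_tx x_rx in
  let kap := kappa alpha A A' x_rx in
  P_circ P beta (lpl_u alpha A A' tri) x_tx x_rx (vertical_points Psi) lf =
  (expR (- (pI * lambda_y * zeta * calY alpha tri (enorm x_rx) zeta kap Ry)))%:E.
Proof.
move=> alpha1 beta0 A0 A'0 tri0 triR lam0 /andP[pI0 _] x_rx x_tx xy neq ppp marks
  zeta kap.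
have alpha0 : 0 < alpha by exact: lt_trans alpha1.
set l := lpl_u alpha A A' tri x_tx x_rx.
have l0 : 0 < l by exact: lpl_u_gt0.
have z0 : 0 < zeta by rewrite powR_gt0// divr_gt0// mulr_gt0.
have zE : zeta `^ alpha = A * beta / l.
  by rewrite /zeta /zeta_u -powRrM mulVf ?gt_eqF// powRr1// ltW// divr_gt0// mulr_gt0.
(* Thus [zeta] absorbs the constants: the attenuation at total distance [v] becomes [v / zeta] to
   the power [- alpha]. *)
have zNE : A * (beta / l) = zeta^-1 `^ (- alpha).
  by rewrite -(powR_inv1 (ltW z0)) -powRrM mulrNN mul1r zE mulrA.
pose r := `|xr|.
have r0 : 0 <= r by exact: normr_ge0.
have rE : enorm x_rx = r by rewrite /x_rx enorm_e_x.
pose s (y : R) := beta / l * lpl_u alpha A A' tri (y *: e_y) x_rx.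
have sE y : s y = if tri < Num.min `|y| r
    then beta / l * (A' * (`|y| * r) `^ (- alpha))
    else beta / l * (A * (`|y| + r) `^ (- alpha)).
  by rewrite /s lpl_u_road; case: ifP.
have s0 y : 0 <= s y.
  have bl0 : 0 <= beta / l by rewrite divr_ge0// ltW.
  by rewrite sE; case: ifP => _; apply: mulr_ge0 => //; apply: mulr_ge0;
    rewrite ?powR_ge0// ltW.
have ms : measurable_fun setT s.
  have mnorm : measurable_fun setT (fun y : R => `|y|) by exact: measurableT_comp.
  have mpow (f : R -> R) : measurable_fun setT f ->
      measurable_fun setT (fun y => f y `^ (- alpha)).
    by move=> mf; apply: (measurableT_comp (f := fun x : R => x `^ (- alpha)) (measurable_powR _)).
  have mt : measurable_fun setT (fun y : R => tri < Num.min `|y| r).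
    by apply: measurable_fun_ltr => //; exact: measurable_minr.
  have mNLOS : measurable_fun setT
      (fun y : R => beta / l * (A' * (`|y| * r) `^ (- alpha))).
    do 2 apply: measurable_funM => //; apply: mpow; exact: measurable_funM.
  have mWLOS : measurable_fun setT
      (fun y : R => beta / l * (A * (`|y| + r) `^ (- alpha))).
    do 2 apply: measurable_funM => //; apply: mpow; exact: measurable_funD.
  apply: eq_measurable_fun (measurable_fun_ifT mt mNLOS mWLOS) => y _.
  by rewrite sE.
have BE : [set y : R | `|y| <= Ry] = `[(- Ry)%R, Ry]%classic.
  by apply/seteqP; split=> y; rewrite /= in_itv/= ler_norml.
have mB : measurable [set y : R | `|y| <= Ry] by rewrite BE.
have Bfin : (lebesgue_measure [set y : R | (`|y| <= Ry)%R] < +oo)%E.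
  rewrite BE lebesgue_measure_itv/=; case: ifP => _; rewrite ?ltry//.
have [Psifin _ _ _] := ppp.
rewrite /P_circ unlock.
transitivity (\int[P]_w (expR (- \sum_(y <- fset_set (Psi w))
    lf w (y *: e_y) * s y))%:E)%E.
  apply: eq_integral => w _; congr (expR _)%:E.
  rewrite interferenceE; last by case: (Psifin w).
  rewrite mulNr mulr_sumr; congr (- _); apply: eq_bigr => y _.
  by rewrite /s mulrCA.
rewrite (laplace_marked_ppp P (pI * lambda_y) _ Psi (fun w y => lf w (y *: e_y))
  _ mB Bfin ppp s marks ms s0); last by rewrite mulr_ge0// ltW.
congr (expR (- _))%:E; rewrite -[RHS]mulrA; congr (_ * _).
rewrite rE.
have k0 : tri < r -> 0 < kap.
  move=> tr; rewrite /kap /kappa rE mulr_gt0//; last exact: lt_trans tr.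
  by rewrite powR_gt0// divr_gt0.
rewrite -(@integral_path_gain_road R alpha alpha1 (fun y => 1 - (1 + s y)^-1))//.
- by apply: measurable_funB => //; exact: measurable_inv1D.
- move=> y; rewrite subr_ge0 invf_le1 ?lerDl// ltr_wpDr//.
- move=> y y0; have ay0 : 0 < `|y| by rewrite normr_gt0.
  rewrite sE; case: ifP => [|_].
    rewrite lt_min => /andP[ty tr].
    have rr0 : 0 < r by exact: lt_trans tr.
    have kp : 0 < kap * `|y| by rewrite mulr_gt0// k0.
    have AA0 : 0 < A / A' by rewrite divr_gt0.
    rewrite -sub_inv1D_powRN; last by rewrite divr_gt0.
    congr (1 - (1 + _)^-1).
    rewrite (powRM _ (ltW kp)) ?invr_ge0 ?(ltW z0)// -zNE.
    (* The constant [kap] converts one law into the other: [A] times its power [- alpha] equals [A']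
       times that of [r], so beyond the break-point [kap * |y|] acts as the total distance. *)
    have kapE : kap `^ (- alpha) = (A / A')^-1 * r `^ (- alpha).
      rewrite /kap /kappa rE powRM ?powR_ge0//.
      by rewrite -powRrM mulrN mulVf ?gt_eqF// powR_inv1// ltW.
    rewrite [(kap * _) `^ _]powRM ?(ltW (k0 tr))// kapE powRM//.
    by field; rewrite !gt_eqF.
  have yr0 : 0 < `|y| + r by rewrite ltr_wpDr.
  rewrite -sub_inv1D_powRN; last by rewrite divr_gt0.
  congr (1 - (1 + _)^-1).
  rewrite (powRM _ (ltW yr0)) ?invr_ge0 ?(ltW z0)// -zNE.
  by ring.
Qed.
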